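(* Let $p$ be a prime, let $n\ge 1$, and let $G$ be isomorphic to the Hanaki group $A(n,p)$. Then the signless Laplacian spectrum of the non-commuting graph $\Gamma_G$ is $$\left\{(p^{3n}-p^{2n})^{(p^n+1)(p^{2n}-p^n-1)},\ (p^{3n}-2p^{2n}+p^n)^{p^n},\ (2p^{3n}-2p^{2n})^1\right\}$$ and its signless Laplacian energy is $LE^+(\Gamma_G)=2p^{2n}(p^n-1)$.
   Context: The group $A(n,p)$ consists of the matrices $V(a,b,c)=\begin{bmatrix}1&0&0\\ a&1&0\\ b&c&1\end{bmatrix}$ with $a,b,c\in GF(p^n)$, under matrix multiplication, so $V(a,b,c)V(a',b',c')=V(a+a',\,b+b'+ca',\,c+c')$. For a finite non-abelian group $G$ with center $Z(G)$, the non-commuting graph $\Gamma_G$ is the simple undirected graph with vertex set $G\setminus Z(G)$ in which $x,y$ are adjacent iff $xy\ne yx$. For a finite simple graph $\mathcal G$ with vertex set $v(\mathcal G)$, edge set $e(\mathcal G)$, adjacency matrix $A(\mathcal G)$ and diagonal degree matrix $D(\mathcal G)$, the signless Laplacian matrix is $Q(\mathcal G)=D(\mathcal G)+A(\mathcal G)$, and its signless Laplacian spectrum is the multiset of eigenvalues of $Q(\mathcal G)$. The notation $\{(\gamma_1)^{d_1},\dots,(\gamma_l)^{d_l}\}$ means the multiset in which $\gamma_r$ is listed $d_r$ times. The signless Laplacian energy is $LE^+(\mathcal G)=\sum_{\gamma}\left|\gamma-\frac{2|e(\mathcal G)|}{|v(\mathcal G)|}\right|$, the sum being over the signless Laplacian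 spectrum with multiplicity. *)

(* Defs.v *)
From mathcomp Require Import all_boot all_order all_algebra all_fingroup.
From mathcomp Require Import all_solvable.

Set Implicit Arguments.
Unset Strict Implicit.
Unset Printing Implicit Defensive.

Import GroupScope GRing.Theory Num.Theory.
Local Open Scope ring_scope.

Record sgraph := SGraph {
  vertex :> finType;
  adj : rel vertex;
  adj_sym : symmetric adj;
  adj_irr : irreflexive adj
}.

Definition edges (g : sgraph) : {set {set g}} :=
  [set [set x; y] | x in [set: g], y in [set: g] & adj x y].

Definition degree (g : sgraph) (x : g) : nat := #|[set y : g | adj x y]|.

Section SignlessLaplacian.
Variables (C : numClosedFieldType) (g : sgraph).

Definition adjacency_mx : 'M[C]_#|g| :=
  \matrix_(i, j) (adj (enum_val i) (enum_val j))%:R.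

Definition degree_mx : 'M[C]_#|g| :=
  diag_mx (\row_i (degree (enum_val i))%:R).

Definition signless_laplacian : 'M[C]_#|g| := degree_mx + adjacency_mx.

End SignlessLaplacian.

(* The roots of the characteristic polynomial with their multiplicities; the
   order of the list is not significant, so compare spectra with [perm_eq]. *)
Definition spectrum (C : numClosedFieldType) (m : nat) (M : 'M[C]_m) : seq C :=
  sval (closed_field_poly_normal (char_poly M)).

Lemma spectrumP (C : numClosedFieldType) (m : nat) (M : 'M[C]_m) :
  char_poly M = \prod_(x <- spectrum M) ('X - x%:P).
Proof.
rewrite /spectrum; case: closed_field_poly_normal => r /= {1}->.
by rewrite (monicP (char_poly_monic M)) scale1r.
Qed.

Definition signless_spectrum (C : numClosedFieldType) (g : sgraph) : seq C :=
  spectrum (signless_laplacian C g).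

Definition signless_energy (C : numClosedFieldType) (g : sgraph) : C :=
  \sum_(x <- signless_spectrum C g) `|x - (2 * #|edges g|)%:R / #|g|%:R|.

Section NonCommutingGraph.
Variables (gT : finGroupType) (G : {group gT}).

Definition noncentral : finType := {x : gT | x \in G :\: 'Z(G)}.

Definition noncommute (x y : noncentral) : bool :=
  (val x * val y != val y * val x)%g.

Lemma noncommute_sym : symmetric noncommute.
Proof. by move=> x y; rewrite /noncommute eq_sym. Qed.

Lemma noncommute_irr : irreflexive noncommute.
Proof. by move=> x; rewrite /noncommute eqxx. Qed.

Definition noncommuting_graph : sgraph :=
  SGraph noncommute_sym noncommute_irr.

End NonCommutingGraph.

Section Hanaki.
Variable F : finFieldType.

Definition hanaki_mx (a b c : F) : 'M[F]_3 :=
  \matrix_(i, j) nth 0 (nth [::] [:: [:: 1; 0; 0];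
                                     [:: a; 1; 0];
                                     [:: b; c; 1]] i) j.

Lemma hanaki_mx1 : hanaki_mx 0 0 0 = 1%:M.
Proof.
apply/matrixP=> i j; rewrite !mxE.
by case: i => [[|[|[|//]]] ?]; case: j => [[|[|[|//]]] ?].
Qed.

Lemma hanaki_mxM a b c a' b' c' :
  hanaki_mx a b c *m hanaki_mx a' b' c' =
  hanaki_mx (a + a') (b + b' + c * a') (c + c').
Proof.
apply/matrixP=> i j; rewrite !mxE !big_ord_recl big_ord0 !mxE.
case: i => [[|[|[|//]]] ?]; case: j => [[|[|[|//]]] ?] /=;
  rewrite ?(mulr0, mul0r, mulr1, mul1r, addr0, add0r) //.
- by rewrite -addrA [c * a' + _]addrC.
Qed.

Definition hanaki_set : {set {'GL_3[F]}} :=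
  [set u : {'GL_3[F]} | [exists a : F, exists b : F, exists c : F,
     (\val u : 'M[F]_3) == hanaki_mx a b c]].

Lemma hanaki_group_set : group_set hanaki_set.
Proof.
have inP (u : {'GL_3[F]}) :
    reflect (exists a b c, (\val u : 'M[F]_3) = hanaki_mx a b c)
                     (u \in hanaki_set).
  rewrite inE; apply: (iffP existsP) => [[a /existsP[b /existsP[c /eqP e]]]|].
    by exists a, b, c.
  move=> [a [b [c e]]]; exists a; apply/existsP; exists b.
  by apply/existsP; exists c; rewrite e.
apply/group_setP; split; first by apply/inP; exists 0, 0, 0; rewrite hanaki_mx1.
move=> u v /inP[a [b [c eu]]] /inP[a' [b' [c' ev]]]; apply/inP.
exists (a + a'), (b + b' + c * a'), (c + c').
by rewrite -hanaki_mxM -eu -ev.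
Qed.

(* A(n,p) when #|F| = p ^ n *)
Definition hanaki_group : {group {'GL_3[F]}} := Group hanaki_group_set.

End Hanaki.

(* Main.v *)
(* Put q = p^n. Two noncentral elements V(a,b,c), V(a',b',c') commute iff
   c a' = c' a, i.e. iff they have the same slope c / a in the projective line
   over F. Hence the graph is complete multipartite with q + 1 parts of size
   m = q (q - 1), and it is regular of degree q m. With P the incidence matrix
   between parts and vertices, Q = q m I + P^T (J - I) P and P P^T = m I, so
   two applications of det(t - A B) ~ det(t - B A) (first to pass from vertices
   to parts, then to pass from the all-ones matrix J to a 1 x 1 matrix) give the
   characteristic polynomial. *)
Require Import Defs.
From mathcomp Require Import all_boot all_order all_algebra all_fingroup.
From mathcomp Require Import all_solvable.
From mathcomp Require Import ring.

Set Implicit Arguments.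
Unset Strict Implicit.
Unset Printing Implicit Defensive.

Import GroupScope GRing.Theory Num.Theory.
Local Open Scope ring_scope.

(** * Determinant identities over commutative rings *)

(** Both sides are [t ^+ n * \det M] for one block matrix [M], made block triangular by a factor on
    the right or on the left. The powers of [t] avoid any division. *)
Lemma det_sub_mulmxC (R : comPzRingType) (m n : nat) (t : R)
    (A : 'M[R]_(m, n)) (B : 'M[R]_(n, m)) :
  t ^+ n * \det (t%:M - A *m B) = t ^+ m * \det (t%:M - B *m A).
Proof.
pose M := block_mx t%:M A B 1%:M.
have detM : \det M = \det (t%:M - A *m B).
  have: M *m block_mx 1%:M 0 (- B) 1%:M = block_mx (t%:M - A *m B) A 0 1%:M.
    rewrite mulmx_block !mulmx1 !mul1mx !mulmx0 !add0r mulmxN.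
    by rewrite subrr.
  by move/(congr1 determinant); rewrite det_mulmx det_lblock det_ublock !det1 !mulr1.
have: block_mx 1%:M 0 (- B) t%:M *m M = block_mx t%:M A 0 (t%:M - B *m A).
  rewrite mulmx_block !mul1mx !mul0mx !addr0 mulmx1 mulNmx.
  by rewrite -scalar_mxC addNr addrC mulNmx.
move/(congr1 determinant).
by rewrite det_mulmx det_lblock det_ublock det1 mul1r !det_scalar detM.
Qed.

(** The constant matrix has rank one, a column times a row, so swapping these factors leaves a 1 x 1
    determinant. *)
Lemma det_scalar_sub_const (R : comPzRingType) (k : nat) (a b : R) :
  a * \det (a%:M - const_mx b : 'M_k) = a ^+ k * (a - b *+ k).
Proof.
have -> : const_mx b = (const_mx b : 'M_(k, 1)) *m (const_mx 1 : 'M_(1, k)).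
  by apply/matrixP=> i j; rewrite !mxE big_ord1 !mxE mulr1.
rewrite -[X in X * _ = _]expr1 det_sub_mulmxC; congr (_ * _).
rewrite [_ *m _](_ : _ = (b *+ k)%:M) -?raddfB ?det_scalar1 //.
apply/matrixP=> i j; rewrite !mxE !ord1 eqxx.
under eq_bigr do rewrite !mxE mul1r.
by rewrite sumr_const card_ord.
Qed.

(** Moving [P^T] to the right end turns the matrix into [(t + m) I - m J] of size [k]. The factor
    [t + m] is the [a] of the preceding lemma. *)
Lemma det_scalar_sub_multipartite (R : comPzRingType) (k n : nat) (m t : R)
    (P : 'M[R]_(k, n)) :
  P *m P^T = m%:M ->
  t ^+ k * (t + m) * \det (t%:M - P^T *m (const_mx 1 - 1%:M) *m P) =
  t ^+ n * (t + m) ^+ k * (t + m - m *+ k).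
Proof.
move=> PPt.
have detE : t ^+ k * \det (t%:M - P^T *m (const_mx 1 - 1%:M) *m P) =
    t ^+ n * \det ((t + m)%:M - const_mx m : 'M_k).
  rewrite -mulmxA det_sub_mulmxC -mulmxA PPt mul_mx_scalar scalerBr.
  rewrite scale_scalar_mx mulr1 opprB addrA raddfD.
  by congr (_ * \det (_ - _)); apply/matrixP=> i j; rewrite !mxE mulr1.
by rewrite mulrAC detE -!mulrA [\det _ * _]mulrC det_scalar_sub_const.
Qed.

(** * Double counting of edges *)

Lemma handshake (g : sgraph) : (2 * #|edges g| = \sum_(x : g) degree x)%N.
Proof.
pose D := [set u : g * g | adj u.1 u.2].
have -> : (\sum_(x : g) degree x = #|D|)%N.
  rewrite -sum1_card (eq_bigl (fun u : g * g => true && adj u.1 u.2)); last first.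
    by move=> u; rewrite inE.
  rewrite -(pair_big_dep predT (@adj g) (fun _ _ => 1%N)) /=.
  by apply: eq_bigr => x _; rewrite sum1dep_card.
rewrite -[in RHS]sum1_card (partition_big (fun u : g * g => [set u.1; u.2])
  (mem (edges g))) /=; last first.
  move=> [x y]; rewrite inE /= => xy; apply/imset2P; exists x y => //.
  by rewrite !inE.
rewrite mulnC -sum_nat_const; apply: eq_bigr => e.
case/imset2P => x y _; rewrite !inE /= => xy ->.
have xNy : x != y by apply: contraTneq xy => ->; rewrite adj_irr.
(* The 2 becomes the cardinal of [[set (x, y); (y, x)]], the ordered pairs lying over the edge. *)
rewrite sum1dep_card -[2%N]/((true : nat).+1).
have <- : ((x, y) != (y, x)) = true by rewrite xpair_eqE negb_and xNy.
rewrite -cards2; apply: eq_card => -[u v]; rewrite !inE /= !xpair_eqE.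
apply/idP/andP=> [/orP[]/andP[/eqP-> /eqP->]|[uv /eqP euv]].
- by rewrite xy.
- by rewrite adj_sym xy setUC.
have uNv : u != v by apply: contraTneq uv => ->; rewrite adj_irr.
have: u \in [set x; y] by rewrite -euv set21.
have: v \in [set x; y] by rewrite -euv set22.
rewrite !inE => /orP[]/eqP ev /orP[]/eqP eu; subst; rewrite ?eqxx ?orbT //.
- by rewrite eqxx in uNv.
- by rewrite eqxx in uNv.
Qed.

(** * Complete multipartite graphs with equal parts, the fibers of [f] *)

Section BalancedMultipartite.
Variables (g : sgraph) (T : finType) (f : g -> T) (m k : nat).
Hypothesis adjE : forall x y : g, adj x y = (f x != f y).
Hypothesis fiber : forall t, #|[set x | f x == t]| = m.
Hypothesis cardT : #|T| = k.+1.

Lemma multipartite_card : #|g| = (k.+1 * m)%N.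
Proof.
rewrite -cardT -sum_nat_const -[LHS]sum1_card (partition_big f predT) //=.
by apply: eq_bigr => t _; rewrite sum1dep_card fiber.
Qed.

Lemma multipartite_degree (x : g) : degree x = (k * m)%N.
Proof.
have := cardsC [set y | f y == f x].
rewrite fiber multipartite_card mulSn => /addnI <-.
by apply: eq_card => y; rewrite !inE adjE eq_sym.
Qed.

Lemma multipartite_edges : (2 * #|edges g| = #|g| * (k * m))%N.
Proof.
rewrite handshake (eq_bigr (fun=> (k * m)%N)) ?sum_nat_const // => x _.
exact: multipartite_degree.
Qed.

Variable C : numClosedFieldType.

(** The determinant identity is applied over [{poly C}] with [t] equal to ['X] minus the common
    degree; the degree matrix is thus absorbed into [t]. *)
Lemma multipartite_char_poly : (0 < m)%N ->
  char_poly (signless_laplacian C g) =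
  ('X - (k * m)%:R%:P) ^+ (k.+1 * m.-1)
  * ('X - ((k * m)%:R - m%:R)%:P) ^+ k
  * ('X - (2 * (k * m)%:R)%:P).
Proof.
move=> m_gt0; set t : {poly C} := 'X - _.
pose P : 'M[{poly C}]_(#|T|, #|g|) :=
  \matrix_(i, j) (f (enum_val j) == enum_val i)%:R.
have PPt : P *m P^T = m%:R%:M.
  apply/matrixP=> i j; rewrite !mxE.
  under eq_bigr do rewrite !mxE.
  rewrite -(big_enum_val (fun x =>
    (f x == enum_val i)%:R * (f x == enum_val j)%:R)).
  have [<-|iNj] := eqVneq i j.
    rewrite mulr1n -(fiber (enum_val i)) -sum1_card natr_sum [RHS]big_mkcond /=.
    apply: eq_big => [x|x _]; rewrite !inE //.
    by case: (f x == _); rewrite ?mulr1 ?mulr0.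
  rewrite big1 // => x _; have [->|] := eqVneq (f x); last by rewrite mul0r.
  by rewrite (inj_eq enum_val_inj) (negPf iNj) mulr0.
(* Each vertex lies in exactly one part; hence [P^T J P = J], while [P^T P] marks the pairs in the
   same part. *)
have P1 j : \sum_i P i j = 1.
  under eq_bigr do rewrite mxE.
  rewrite -(big_enum_val (fun y => (f (enum_val j) == y)%:R)).
  by rewrite (bigD1 (f (enum_val j))) //= eqxx big1 ?addr0 // => y;
    rewrite eq_sym => /negPf ->.
have QE : P^T *m (const_mx 1 - 1%:M) *m P = map_mx polyC (adjacency_mx C g).
  have P1P : P^T *m const_mx 1 *m P = const_mx 1.
    apply/matrixP=> i j; rewrite !mxE -[RHS](P1 j).
    apply: eq_bigr => l _; rewrite !mxE -[RHS]mul1r; congr (_ * _).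
    by rewrite -[RHS](P1 i); apply: eq_bigr => h _; rewrite !mxE mulr1.
  rewrite mulmxBr mulmxBl mulmx1 P1P; apply/matrixP=> i j; rewrite !mxE.
  under eq_bigr do rewrite !mxE.
  rewrite -(big_enum_val (fun y =>
    (f (enum_val i) == y)%:R * (f (enum_val j) == y)%:R)).
  rewrite (bigD1 (f (enum_val i))) //= eqxx mul1r big1 => [|y]; last first.
    by rewrite eq_sym => /negPf ->; rewrite mul0r.
  rewrite addr0 adjE rmorph_nat eq_sym.
  by case: (_ == _); rewrite ?subrr ?subr0.
have -> : char_poly (signless_laplacian C g) =
    \det (t%:M - P^T *m (const_mx 1 - 1%:M) *m P).
  rewrite QE; congr (\det _); apply/matrixP=> i j; rewrite !mxE.
  rewrite multipartite_degree raddfD /= raddfMn /= !rmorph_nat.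
  by rewrite /t rmorph_nat mulrnBl opprD addrA.
have := det_scalar_sub_multipartite t PPt; move: (\det (t%:M - _)) => D.
(* The order [k.+1 * m] splits as [k.+1 + k.+1 * m.-1], which exposes the power of [t] to be
   cancelled. *)
rewrite cardT multipartite_card -[m in (_ * m)%N](prednK m_gt0) mulnS exprD.
have tmE : 'X - ((k * m)%:R - m%:R)%:P = t + m%:R :> {poly C}.
  by rewrite /t rmorphB /= !rmorph_nat opprB addrA addrAC.
have -> : 'X - (2 * (k * m)%:R)%:P = t + m%:R - m%:R *+ k.+1 :> {poly C}.
  rewrite /t rmorphM /= !rmorph_nat -[m%:R *+ k.+1]mulr_natl.
  ring.
(* Polynomials over a field form a domain, so this nonzero factor can be cancelled. *)
have t_neq0 : t ^+ k.+1 * (t + m%:R) != 0.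
  by rewrite -tmE mulf_neq0 ?expf_neq0 ?polyXsubC_eq0.
move=> eqD; apply: (mulfI t_neq0); rewrite eqD tmE [(t + _) ^+ k.+1]exprS.
ring.
Qed.

End BalancedMultipartite.

(** * Coordinates, commutation and slopes in the Hanaki group *)

(** Transporting matrix entries along the isomorphism lets the rest of the proof work with triples
    over [F]. *)
Lemma hanaki_coordinates (F : finFieldType) (gT : finGroupType) (G : {group gT}) :
  G \isog hanaki_group F ->
  exists (V : F * F * F -> gT) (r : gT -> F * F * F),
  [/\ cancel V r, {in G, cancel r V}, forall u, V u \in G
    & forall a b c a' b' c',
      (V (a, b, c) * V (a', b', c'))%g = V (a + a', b + b' + c * a', c + c')].
Proof.
rewrite isog_sym => /isogP[h injh hG].
have Uhan (u : F * F * F) : hanaki_mx u.1.1 u.1.2 u.2 \in unitmx.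
  case: u => [[a b] c] /=.
  (* The second factor is the inverse, found by solving the product rule for the identity. *)
  have: hanaki_mx a b c *m hanaki_mx (- a) (- b + c * a) (- c) = 1%:M.
    by rewrite hanaki_mxM !subrr mulrN addrA subrr add0r subrr hanaki_mx1.
  by case/mulmx1_unit.
pose U u : {'GL_3[F]} := FinRing.Unit (Uhan u).
have UH u : U u \in hanaki_group F.
  rewrite inE; apply/existsP; exists u.1.1; apply/existsP; exists u.1.2.
  by apply/existsP; exists u.2.
pose s (w : {'GL_3[F]}) : F * F * F :=
  let M := val w : 'M_3 in (M 1 0, M 2%:R 0, M 2%:R 1).
have UK : cancel U s by case=> [[a b] c]; rewrite /s /= !mxE.
have sK : {in hanaki_group F, cancel s U}.
  move=> w; rewrite inE => /existsP[a /existsP[b /existsP[c /eqP ew]]].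
  by apply: val_inj; rewrite /= ew /= !mxE.
exists (h \o U), (s \o invm injh); split=> [u|x|u|a b c a' b' c'] /=.
- by rewrite invmE.
- rewrite -hG => xG; rewrite sK; first exact: invmK.
  by have := mem_morphim (invm injh) xG xG; rewrite im_invm.
- by rewrite -hG; apply: mem_morphim.
- rewrite -morphM //; congr (h _); apply: val_inj.
  exact: hanaki_mxM.
Qed.

Section HanakiSlope.
Variables (F : finFieldType) (gT : finGroupType) (G : {group gT}).
Variables (V : F * F * F -> gT) (r : gT -> F * F * F).
Hypothesis VK : cancel V r.
Hypothesis rK : {in G, cancel r V}.
Hypothesis VG : forall u, V u \in G.
Hypothesis VM : forall a b c a' b' c',
  (V (a, b, c) * V (a', b', c'))%g = V (a + a', b + b' + c * a', c + c').

Lemma hanaki_commute a b c a' b' c' :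
  (V (a, b, c) * V (a', b', c') == V (a', b', c') * V (a, b, c))%g
  = (c * a' == c' * a).
Proof.
rewrite !VM (inj_eq (can_inj VK)) !xpair_eqE [a + _]addrC [c + _]addrC !eqxx.
by rewrite [b + _]addrC (inj_eq (addrI _)) andbT.
Qed.

Lemma hanaki_center a b c :
  (V (a, b, c) \in 'Z(G)) = (a == 0) && (c == 0).
Proof.
apply/centerP/andP=> [[_ Vcent]|[/eqP-> /eqP->]]; last first.
  split=> // x /rK <-; case: (r x) => [[a' b'] c'].
  by apply/eqP; rewrite hanaki_commute mul0r mulr0.
(* Commuting with [V (0, 0, 1)] forces [a = 0], and with [V (1, 0, 0)] forces [c = 0]. *)
split; rewrite eq_sym.
  by have /eqP := Vcent _ (VG (0, 0, 1)); rewrite hanaki_commute mulr0 mul1r.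
by have /eqP := Vcent _ (VG (1, 0, 0)); rewrite hanaki_commute mulr1 mul0r eq_sym.
Qed.

(* [option F] models the projective line over [F], with [None] at infinity. *)
Definition slope_of (u : F * F * F) : option F :=
  let: (a, _, c) := u in if a == 0 then None else Some (c / a).

Definition slope (x : noncommuting_graph G) : option F := slope_of (r (val x)).

Lemma noncentral_coordinates (x : noncommuting_graph G) :
  exists a b c, [/\ val x = V (a, b, c), (a == 0) && (c == 0) = false
                  & slope x = slope_of (a, b, c)].
Proof.
have := valP x; rewrite /slope inE => /andP[xNZ /rK].
case: (r _) => [[a b] c] ex; exists a, b, c; split=> //.
by apply: negbTE; rewrite -(hanaki_center a b) ex.
Qed.

Lemma slope_adj (x y : noncommuting_graph G) : adj x y = (slope x != slope y).
Proof.
have [a [b [c [ex ac0 ->]]]] := noncentral_coordinates x.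
have [a' [b' [c' [ey ac0' ->]]]] := noncentral_coordinates y.
transitivity (c * a' != c' * a).
  by rewrite -(hanaki_commute a b c a' b' c') -ex -ey.
rewrite /slope_of; congr negb; move: ac0 ac0'.
(* When exactly one of [a], [a'] vanishes, noncentrality makes the matching [c] nonzero, so the
   cross products differ. *)
have [->|a0] := eqVneq a 0; have [->|a0'] := eqVneq a' 0 => /=.
- by rewrite !mulr0 !eqxx.
- by rewrite mulr0 mulf_eq0 (negPf a0') orbF.
- by rewrite mulr0 [0 == _]eq_sym mulf_eq0 (negPf a0) orbF.
- by move=> _ _; rewrite (inj_eq (@Some_inj _)) eqr_div.
Qed.

(** A slope fixes a line through the origin of the [(a, c)] plane. The vertices over it are given by
    a nonzero parameter on that line and a free [b]. *)
Lemma slope_fiber (t : option F) :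
  #|[set x | slope x == t]| = (#|F| * #|F|.-1)%N.
Proof.
pose W (u : F * F) := V (if t is Some s then (u.1, u.2, s * u.1) else (0, u.2, u.1)).
have W_inj : injective W.
  by move=> [l b] [l' b'] /(can_inj VK); case: (t) => [s|] [] // -> ->.
have <- : #|setX [set~ 0 : F] [set: F]| = (#|F| * #|F|.-1)%N.
  by rewrite cardsX cardsT cardsC1 mulnC.
(* Both sets are compared as subsets of [gT], since vertices form a subtype. *)
rewrite -(card_imset _ W_inj) -(card_imset _ val_inj).
apply: eq_card => x; apply/imsetP/imsetP.
  case=> y; rewrite inE => /eqP yt ->; rewrite /W -{}yt.
  have [a [b [c [-> + ->]]]] := noncentral_coordinates y.
  rewrite /slope_of; have [->|a0 _] := eqVneq a 0 => /= [c0|].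
    by exists (c, b); rewrite ?inE ?c0.
  by exists (a, b); rewrite ?inE ?a0 //= divfK.
case=> -[l b]; rewrite !inE andbT /= => l0 ->.
have WNZ : W (l, b) \in G :\: 'Z(G).
  rewrite inE VG andbT /W /=.
  by case: (t) => [s|]; rewrite hanaki_center (negPf l0) // andbF.
exists (exist (fun x => x \in G :\: 'Z(G)) _ WNZ) => //; rewrite inE /slope /= /W VK.
by case: (t) => [s|] /=; rewrite ?eqxx // (negPf l0) mulfK.
Qed.

End HanakiSlope.

Theorem theorem5p5 (C : numClosedFieldType) (p n : nat) (F : finFieldType)
    (gT : finGroupType) (G : {group gT}) :
  prime p -> (1 <= n)%N -> #|F| = (p ^ n)%N ->
  G \isog hanaki_group F ->
  perm_eq (signless_spectrum C (noncommuting_graph G))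
    (nseq ((p ^ n + 1) * (p ^ (2 * n) - p ^ n - 1))%N
       (p%:R ^+ (3 * n) - p%:R ^+ (2 * n))
     ++ nseq (p ^ n)%N
       (p%:R ^+ (3 * n) - 2 * p%:R ^+ (2 * n) + p%:R ^+ n)
     ++ nseq 1 (2 * p%:R ^+ (3 * n) - 2 * p%:R ^+ (2 * n)))
  /\ signless_energy C (noncommuting_graph G) =
       2 * p%:R ^+ (2 * n) * (p%:R ^+ n - 1).
Proof.
move=> p_pr n_gt0 cardF /hanaki_coordinates[V [r [VK rK VG VM]]].
(* The parts are indexed by the projective line, so [k = q] and [m = q * q.-1]. *)
have cardT : #|{: option F}| = (p ^ n).+1 by rewrite card_option cardF.
have adjE := slope_adj VK rK VG VM.
have fiber := slope_fiber VK rK VG VM; rewrite cardF in fiber.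
set q := (p ^ n)%N in cardT fiber *.
have q_gt1 : (1 < q)%N by rewrite -(exp1n n) ltn_exp2r ?prime_gt1.
have m_gt0 : (0 < q * q.-1)%N by rewrite muln_gt0 -(subn1 q) subn_gt0 q_gt1 ltnW.
have mE : (q * q.-1)%:R = q%:R ^+ 2 - q%:R :> C.
  by rewrite natrM -subn1 natrB ?(ltnW q_gt1) // mulrBr mulr1.
have kmE : (q * (q * q.-1))%:R = q%:R ^+ 3 - q%:R ^+ 2 :> C.
  by rewrite natrM mE; ring.
have pX e : p%:R ^+ (e * n) = q%:R ^+ e :> C by rewrite natrX -exprM mulnC.
have p1 : p%:R ^+ n = q%:R :> C by rewrite natrX.
rewrite !pX p1 [(2 * n)%N]mulnC expnM -/q.
have spec : perm_eq (signless_spectrum C (noncommuting_graph G))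
    (nseq ((q + 1) * (q ^ 2 - q - 1))%N (q%:R ^+ 3 - q%:R ^+ 2)
     ++ nseq q (q%:R ^+ 3 - 2 * q%:R ^+ 2 + q%:R)
     ++ nseq 1 (2 * q%:R ^+ 3 - 2 * q%:R ^+ 2)).
  (* A multiset of roots is determined by its product of linear factors. *)
  apply: prod_XsubC_eq; rewrite -spectrumP !big_cat !big_nseq /=.
  rewrite (multipartite_char_poly adjE fiber cardT C m_gt0) kmE mE.
  rewrite !GRing.iter_mulr_1 mulr1 -mulrA.
  congr (_ ^+ _ * (_ ^+ _ * _)).
  - by rewrite addn1 subn1 -[in LHS](subn1 q) mulnBr muln1.
  - by congr (_ - _%:P); ring.
  - by congr (_ - _%:P); ring.
split=> //.
(* By regularity the average degree is the common degree, which is also the first eigenvalue; its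
   terms drop out of the energy. *)
have avg : (2 * #|edges (noncommuting_graph G)|)%:R / #|noncommuting_graph G|%:R
    = q%:R ^+ 3 - q%:R ^+ 2 :> C.
  rewrite (multipartite_edges adjE fiber cardT) natrM mulrAC mulfV ?mul1r //.
  by rewrite pnatr_eq0 -lt0n (multipartite_card fiber cardT) muln_gt0.
transitivity (\sum_(x <- signless_spectrum C (noncommuting_graph G))
    `|x - (q%:R ^+ 3 - q%:R ^+ 2)|).
  by rewrite -avg.
rewrite (perm_big _ spec) !big_cat !big_nseq /=.
rewrite !GRing.iter_addr_0 subrr normr0 mul0rn add0r addr0.
(* The remaining deviations are [- m], taken [q] times, and [q * m], taken once. As casts of
   naturals up to sign, they have immediate norms, with sum [2 * q * m]. *)
have -> : q%:R ^+ 3 - 2 * q%:R ^+ 2 + q%:R - (q%:R ^+ 3 - q%:R ^+ 2)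
    = - (q * q.-1)%:R :> C by rewrite mE; ring.
have -> : 2 * q%:R ^+ 3 - 2 * q%:R ^+ 2 - (q%:R ^+ 3 - q%:R ^+ 2)
    = (q * (q * q.-1))%:R :> C by rewrite kmE; ring.
by rewrite normrN !normr_nat -mulr_natl kmE mE; ring.
Qed.
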